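(* Let $\boldsymbol\mu\in\mathcal P^0_{\max(\gamma,2)}(\mathbb R)$ be any steady measure solution to the self-similar equation such that $$\mathbf m_\gamma:=\int_{\mathbb R}|\xi|^\gamma\,\boldsymbol\mu(d\xi)>0.$$ Then $\boldsymbol\mu$ is absolutely continuous with respect to the Lebesgue measure over $\mathbb R$, i.e. there exists some nonnegative $G\in L^1_{\max(\gamma,2)}(\mathbb R)$ such that $\boldsymbol\mu(d\xi)=G(\xi)\,d\xi$.
   Context: Fix $\gamma>0$, $a\in(0,1)$, $b=1-a$. $\mathcal P_k^0(\mathbb R)$ is the set of Borel probability measures $\mu$ on $\mathbb R$ with $\int|x|^k\mu(dx)<\infty$ and $\int x\,\mu(dx)=0$. $L^1_k(\mathbb R)$ is the set of $f\in L^1(\mathbb R)$ with $\int(1+x^2)^{k/2}|f(x)|dx<\infty$. A measure $\boldsymbol\mu\in\mathcal P^0_{\max(\gamma,2)}(\mathbb R)$ is a steady measure solution to the self-similar equation (formally $\frac{d}{d\xi}(\xi G)=\mathcal Q(G,G)$) if $$-\int_{\mathbb R}\xi\phi'(\xi)\,\boldsymbol\mu(d\xi)=\frac12\int_{\mathbb R^2}|\xi-\eta|^\gamma\big(\phi(a\xi+b\eta)+\phi(a\eta+b\xi)-\phi(\xi)-\phi(\eta)\big)\boldsymbol\mu(d\xi)\boldsymbol\mu(d\eta)$$ for every $\phi\in\mathcal C^1_b(\mathbb R)$ ($C^1$ functions bounded together with their derivative). *)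

(* Defs.v *)
From mathcomp Require Import all_boot all_order all_algebra.
From mathcomp Require Import all_classical all_reals all_analysis.
Import Order.TTheory GRing.Theory Num.Theory.
Import numFieldNormedType.Exports.

Set Implicit Arguments.
Unset Strict Implicit.
Unset Printing Implicit Defensive.

Local Open Scope classical_set_scope.
Local Open Scope ring_scope.

(* The value [0%E] of the last integral already forces integrability of the
   identity: an indeterminate [+oo - oo] evaluates to [-oo], not to [0]. *)
Definition centered_moment_prob (R : realType) (k : R)
    (mu : probability (measurableTypeR R) R) : Prop :=
  (\int[mu]_x (`|x| `^ k)%:E < +oo)%E /\ (\int[mu]_x x%:E = 0)%E.

Definition weighted_L1 (R : realType) (k : R) (f : R -> R) : Prop :=
  (@lebesgue_measure R).-integrable setT (EFin \o f) /\
  (\int[@lebesgue_measure R]_x (((1 + x ^+ 2) `^ (k / 2)) * `|f x|)%:E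
     < +oo)%E.

Definition C1b (R : realType) (phi : R -> R) : Prop :=
  [/\ forall x, derivable phi x 1, continuous (derive1 phi),
      bounded_fun phi & bounded_fun (derive1 phi)].

Definition collision_increment (R : realType) (a : R) (phi : R -> R)
    (xi eta : R) : R :=
  let b := 1 - a in
  phi (a * xi + b * eta) + phi (a * eta + b * xi) - phi xi - phi eta.

Definition steady_measure_solution (R : realType) (gamma a : R)
    (mu : probability (measurableTypeR R) R) : Prop :=
  centered_moment_prob (Num.max gamma 2) mu /\
  forall phi : R -> R, C1b phi ->
    (- (\int[mu]_xi (xi * derive1 phi xi)%:E) =
     (2^-1)%:E * \int[mu \x mu]_z
        (`|z.1 - z.2| `^ gamma * collision_increment a phi z.1 z.2)%:E)%E.

(* Main.v *)
Require Import Defs.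
From mathcomp Require Import all_boot all_order all_algebra.
From mathcomp Require Import all_classical all_reals all_analysis.
From mathcomp Require Import measurable_realfun ring lra.
Import Order.TTheory GRing.Theory Num.Theory.
Import numFieldNormedType.Exports.
Local Open Scope classical_set_scope.
Local Open Scope ring_scope.

(** Written in weak form, the equation says that the distributional derivative of
    the signed measure [x * mu] is a difference of finite measures, namely the
    gain minus the loss of the collision operator.  A measure whose derivative is
    a finite measure has a density (of bounded variation), so [mu] is absolutely
    continuous away from the origin, the only zero of the factor [x]; an atom at
    the origin remains to be excluded.

    The first point is made quantitative, with no theory of distributions, in
    [steady_virial_bound]: if a test function has derivative [psi], then its sup
    norm is at most the [L1] norm of [psi], so the integral of [x * psi x]
    against [mu] is at most a constant times that norm.  Approximating
    indicators of open sets ([steady_open_bound]) and using outer regularity of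
    the Lebesgue measure, [steady_null_off0] follows: [mu] vanishes on Lebesgue
    null sets that avoid the origin.

    For the atom, the equation is tested with bumps shrinking to the origin.
    The transport term disappears in the limit ([bump_limit_equation]), so gain
    and loss at the origin balance.  Since [mu] has no other atom, almost no
    collision of positive rate produces a particle exactly at the origin
    ([gain_on_line_eq0]), so the gain is zero.  The loss is the mass of the atom
    times the moment of order [gamma], which is positive; hence the atom has mass
    zero ([steady_no_atom0]).

    The Radon-Nikodym theorem then gives the density, and its weighted norm is a
    moment of [mu] ([density_weighted_L1]). *)

Local Notation leb := (@lebesgue_measure _).
Local Notation plane R := (measurableTypeR R * measurableTypeR R)%type.

(** * Moments and the total mass of the collision kernel *)

Lemma powR_abs_le1D (R : realType) (p q x : R) : 0 <= p -> p <= q ->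
  `|x| `^ p <= 1 + `|x| `^ q.
Proof.
move=> p0 pq; have [x1|x1] := leP 1 `|x|.
  by rewrite (le_trans (ler_powR x1 pq))// lerDr.
have /le_trans -> // : `|x| `^ p <= 1; last by rewrite lerDl powR_ge0.
have <- : 1 `^ p = 1 by rewrite powR1.
by rewrite ge0_ler_powR ?nnegrE// ltW.
Qed.

Lemma powR_distr_le (R : realType) (p x y : R) : 0 <= p ->
  `|x - y| `^ p <= 2 `^ p * (`|x| `^ p + `|y| `^ p).
Proof.
move=> p0.
have xy : `|x - y| <= 2 * Num.max `|x| `|y|.
  rewrite (le_trans (ler_normB _ _))// mulr_natl mulr2n lerD// le_max lexx//.
  by rewrite orbT.
have m0 : 0 <= Num.max `|x| `|y| by rewrite le_max normr_ge0.
apply: (@le_trans _ _ ((2 * Num.max `|x| `|y|) `^ p)).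
  by rewrite ge0_ler_powR ?nnegrE// mulr_ge0.
rewrite powRM// ler_wpM2l ?powR_ge0//.
by case: (leP `|x| `|y|) => _; rewrite ?lerDr ?lerDl powR_ge0.
Qed.

Lemma measurable_powR_norm (R : realType) d (T : measurableType d) (p : R)
    (f : T -> R) : measurable_fun [set: T] f ->
  measurable_fun [set: T] (fun x => (`|f x| `^ p)%:E).
Proof.
move=> mf; apply/measurable_EFinP.
apply: (measurableT_comp (measurable_powR p)).
exact: measurableT_comp.
Qed.

(** A finite measure integrates the constant 1, which dominates [`|x| `^ p] on
    the unit interval. *)
Lemma moment_finite_le (R : realType) (p q : R)
    (mu : probability (measurableTypeR R) R) : 0 <= p -> p <= q ->
  (\int[mu]_x (`|x| `^ q)%:E < +oo -> \int[mu]_x (`|x| `^ p)%:E < +oo)%E.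
Proof.
move=> p0 pq hq.
apply: (@le_lt_trans _ _ (\int[mu]_x (1%:E + (`|x| `^ q)%:E))%E).
  apply: ge0_le_integral => //.
  - exact: measurable_powR_norm.
  - apply: emeasurable_funD => //; exact: measurable_powR_norm.
  - by move=> x _; rewrite -EFinD lee_fin powR_abs_le1D.
rewrite ge0_integralD//.
- rewrite integral_cst//= mul1e probability_setT lte_add_pinfty// ltry//.
- exact: measurable_powR_norm.
Qed.

Lemma measurable_dist_powR (R : realType) (p : R) :
  measurable_fun [set: plane R]
    (fun z => (`|z.1 - z.2| `^ p)%:E).
Proof.
apply: (@measurable_powR_norm R _ (plane R) p (fun z => z.1 - z.2)).
by apply: measurable_funB; [exact: measurable_fst|exact: measurable_snd].
Qed.

(** The collision kernel has finite total mass; this is the only constant that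
    enters the estimates below. *)
Lemma interaction_finite (R : realType) (p : R)
    (mu : probability (measurableTypeR R) R) : 0 <= p ->
  (\int[mu]_x (`|x| `^ p)%:E < +oo ->
   \int[mu \x mu]_z (`|z.1 - z.2| `^ p)%:E < +oo)%E.
Proof.
move=> p0 hp.
have m1 : measurable_fun [set: plane R]
    (fun z => (`|z.1| `^ p)%:E).
  apply: (@measurable_powR_norm R _ (plane R) p fst); exact: measurable_fst.
have m2 : measurable_fun [set: plane R]
    (fun z => (`|z.2| `^ p)%:E).
  apply: (@measurable_powR_norm R _ (plane R) p snd); exact: measurable_snd.
have g1 (z : plane R) : (0 <= (`|z.1| `^ p)%:E)%E.
  by rewrite lee_fin powR_ge0.
have g2 (z : plane R) : (0 <= (`|z.2| `^ p)%:E)%E.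
  by rewrite lee_fin powR_ge0.
apply: (@le_lt_trans _ _ (\int[mu \x mu]_z
   ((2 `^ p)%:E * ((`|z.1| `^ p)%:E + (`|z.2| `^ p)%:E)))%E).
  apply: ge0_le_integral => //.
  - exact: measurable_dist_powR.
  - by apply: measurable_funeM; exact: (emeasurable_funD m1 m2).
  - by move=> x _; rewrite -EFinD -EFinM lee_fin powR_distr_le.
rewrite ge0_integralZl//; last 2 first.
- by apply: emeasurable_funD; [exact: m1|exact: m2].
- by move=> z _; rewrite adde_ge0.
rewrite ge0_integralD//.
rewrite fubini_tonelli1// fubini_tonelli2// /fubini_F /fubini_G/=.
have cstE (c : R) : (\int[mu]_y c%:E = c%:E)%E.
  by rewrite integral_cst//= probability_setT mule1.
under eq_integral do rewrite cstE.
by rewrite lte_mul_pinfty ?lee_fin ?powR_ge0// lte_add_pinfty.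
Qed.

(** * The virial bound *)

(** The weak equation only sees test functions through their derivative on one
    side and their values on the other.  Integrating from [-oo] turns a
    derivative [psi] into a test function whose sup norm is at most the [L1]
    norm of [psi], which is what makes the two sides comparable. *)
Lemma integrable_continuous_C1b (R : realType) (psi : R -> R) :
  continuous psi -> bounded_fun psi ->
  (leb.-integrable setT (EFin \o psi)) ->
  exists phi : R -> R, [/\ C1b phi, derive1 phi = psi &
    forall x, (`|phi x|%:E <= \int[leb]_t `|psi t|%:E)%E].
Proof.
move=> cpsi bpsi ipsi.
pose phi x := \int[leb]_(t in `]-oo, x]) psi t.
have ips y : leb.-integrable `]-oo, y] (EFin \o psi).
  exact: integrableS ipsi.
have dphi x : derivable phi x 1 /\ derive1 phi x = psi x.
  apply: (@continuous_FTC1 _ psi -oo%O x (x + 1)) => //.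
  - by rewrite ltrDl.
  - by rewrite ltNyr.
  - exact: cpsi.
have phiE : derive1 phi = psi by apply/funext => x; case: (dphi x).
have lephi x : (`|phi x|%:E <= \int[leb]_t `|psi t|%:E)%E.
  rewrite /phi /Rintegral -abse_EFin fineK; last exact: integrable_fin_num.
  apply: (le_trans (le_abse_integral _ _ _)) => //.
    exact: (measurable_int _ (ips x)).
  apply: ge0_subset_integral => //.
  apply: measurableT_comp => //; exact: (measurable_int _ ipsi).
exists phi; split => //; split => //.
- by move=> x; case: (dphi x).
- by rewrite phiE.
- exists (fine (\int[leb]_t `|psi t|%:E)); split; first exact: num_real.
  move=> M hM x _ /=; apply/ltW/le_lt_trans/hM.
  rewrite -lee_fin fineK//.
  move/integrableP : ipsi => [_]; rewrite ge0_fin_numE//.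
  exact: integral_ge0.
- by rewrite phiE.
Qed.

Lemma C1b_measurable (R : realType) (phi : R -> R) : C1b phi ->
  measurable_fun [set: measurableTypeR R] phi.
Proof.
case=> dphi _ _ _; apply: continuous_measurable_fun => x.
exact/differentiable_continuous/derivable1_diffP.
Qed.

Lemma measurable_collision (R : realType) (gamma a : R) (phi : R -> R) :
  measurable_fun [set: measurableTypeR R] phi ->
  measurable_fun [set: plane R] (fun z =>
    (`|z.1 - z.2| `^ gamma * collision_increment a phi z.1 z.2)%:E).
Proof.
move=> mphi; apply/measurable_EFinP; apply: measurable_funM.
  by apply/measurable_EFinP; exact: measurable_dist_powR.
have m1 : measurable_fun [set: plane R] (fun z => z.1 : measurableTypeR R).
  exact: measurable_fst.
have m2 : measurable_fun [set: plane R] (fun z => z.2 : measurableTypeR R).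
  exact: measurable_snd.
have mlin (c d : R) (u v : plane R -> R) : measurable_fun [set: plane R] u ->
    measurable_fun [set: plane R] v ->
    measurable_fun [set: plane R] (fun z => phi (c * u z + d * v z)).
  move=> mu mv; apply: (measurableT_comp mphi).
  by apply: measurable_funD; apply: measurable_funM.
rewrite /collision_increment; apply: measurable_funB; [apply: measurable_funB|].
- by apply: measurable_funD; [exact: (mlin _ _ fst snd)|exact: (mlin _ _ snd fst)].
- exact: (measurableT_comp mphi m1).
- exact: (measurableT_comp mphi m2).
Qed.

Lemma collision_increment_le (R : realType) (a r : R) (phi : R -> R) (x y : R) :
  (forall t, `|phi t| <= r) -> `|collision_increment a phi x y| <= 4 * r.
Proof.
move=> hr; rewrite /collision_increment.
have -> : 4 * r = r + r + r + r by ring.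
rewrite (le_trans (ler_normB _ _))// lerD//.
rewrite (le_trans (ler_normB _ _))// lerD//.
by rewrite (le_trans (ler_normD _ _))// lerD.
Qed.

(** The distributional derivative of [x * mu] is a finite measure.  Tested
    against [psi], this says that [x * mu] is controlled by the Lebesgue [L1]
    norm of [psi]: the collision increment of the antiderivative of [psi] has
    four terms, each at most that norm, and the prefactor [2^-1] halves the
    sum. *)
Lemma steady_virial_bound (R : realType) (gamma a : R)
    (mu : probability (measurableTypeR R) R) (psi : R -> R) :
  steady_measure_solution gamma a mu ->
  continuous psi -> bounded_fun psi ->
  leb.-integrable setT (EFin \o psi) ->
  (`| \int[mu]_x (x * psi x)%:E | <=
   (\int[mu \x mu]_z (`|z.1 - z.2| `^ gamma)%:E) *
   (2%:E * \int[leb]_t `|psi t|%:E))%E.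
Proof.
move=> [_ steady] cpsi bpsi ipsi.
have [phi [C1phi dphi lephi]] := integrable_continuous_C1b _ _ cpsi bpsi ipsi.
have := steady _ C1phi; rewrite dphi => /(congr1 oppe); rewrite oppeK => ->.
have fN : (\int[leb]_t `|psi t|%:E \is a fin_num)%E.
  move/integrableP : ipsi => [_]; rewrite ge0_fin_numE//.
  exact: integral_ge0.
move: fN lephi; case: (\int[leb]_t _)%E => // r _ lephi.
have {}lephi t : `|phi t| <= r by rewrite -lee_fin lephi.
have r0 : 0 <= r by rewrite (le_trans (normr_ge0 (phi 0))).
have mphi := @measurable_collision R gamma a phi (C1b_measurable _ _ C1phi).
rewrite abseN abseM gee0_abs ?lee_fin ?invr_ge0//.
rewrite [leRHS](_ : _ = 2^-1%:E * ((4 * r)%:E * 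
  (\int[mu \x mu]_z (`|z.1 - z.2| `^ gamma)%:E)))%E; last first.
  rewrite muleC !muleA -!EFinM; congr (_%:E * _)%E; by field.
rewrite lee_wpmul2l ?lee_fin ?invr_ge0//.
apply: (le_trans (le_abse_integral _ _ _)) => //.
rewrite -ge0_integralZl//; last 2 first.
- exact: measurable_dist_powR.
- by rewrite lee_fin mulr_ge0.
apply: ge0_le_integral => //.
- exact: measurableT_comp.
- by apply: measurable_funeM; exact: measurable_dist_powR.
- move=> z _; rewrite abse_EFin -EFinM lee_fin normrM mulrC.
  by rewrite (ger0_norm (powR_ge0 _ _)) ler_wpM2r ?powR_ge0// collision_increment_le.
Qed.

(** * Absolute continuity away from the origin *)

(** Truncated multiples of the distance to the complement of [U].  Properness of
    [U] makes that distance finite. *)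
Lemma open_indicator_approx (R : realType) (U : set R) : open U -> U != setT ->
  exists theta : nat -> R -> R, [/\ forall n, continuous (theta n),
    forall n x, 0 <= theta n x <= \1_U x &
    forall x, theta n x @[n --> \oo] --> (\1_U x : R)].
Proof.
move=> oU UT.
have /existsNP[a Ua] : ~ forall x, U x.
  by move=> h; move/eqP : UT; apply; rewrite -subTset => x _; exact: h.
pose D := @edist_inf R R (~` U).
have Dfin x : D x \is a fin_num.
  rewrite ge0_fin_numE ?edist_inf_ge0//; apply: (@le_lt_trans _ _ (edist (x, a))).
    by apply: ereal_inf_lbound; exists a.
  rewrite -ge0_fin_numE ?edist_ge0//; apply/edist_finP => /=.
  exists (`|x - a| + 1); first by rewrite ltr_wpDl.
  by rewrite /ball/= ltrDl.
pose d x := fine (D x).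
have d0 x : 0 <= d x by rewrite fine_ge0// edist_inf_ge0.
have cd : continuous d.
  by move=> x; apply: fine_cvg; rewrite fineK//; exact: edist_inf_continuous.
have dU x : ~ U x -> d x = 0.
  by move=> Ux; rewrite /d /D edist_inf0.
have dUpos x : U x -> 0 < d x.
  move=> Ux; have /nbhs_ballP[e /= e0 eU] : nbhs x U by exact: open_nbhs_nbhs.
  rewrite -lte_fin /d fineK// (@lt_le_trans _ _ e%:E)//.
  apply: le_ereal_inf_tmp => _ [y Uy <-].
  rewrite leNgt; apply/negP => xye; apply: Uy; apply: eU.
  exact: (edist_lt_ball xye).
exists (fun n x => Num.min (n%:R * d x) 1); split.
- move=> n x; apply: (@continuous_min R R (fun x => n%:R * d x) (fun=> 1)).
    apply: continuousM; [exact: cvg_cst|exact: cd].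
  exact: cvg_cst.
- move=> n x; rewrite le_min ler01 mulr_ge0//=.
  have [xU|xU] := boolP (x \in U).
    by rewrite indicE xU ge_min lexx orbT.
  rewrite indicE (negbTE xU)/= dU ?mulr0 ?ge_min ?lexx//.
  by move/mem_set; rewrite (negbTE xU).
- move=> x; rewrite indicE; have [xU|xU] := boolP (x \in U); last first.
    rewrite dU; last by move/mem_set; rewrite (negbTE xU).
    under eq_fun do rewrite mulr0 min_l//; exact: cvg_cst.
  move/set_mem/dUpos : xU => dx.
  apply: cvg_near_cst; exists (Num.truncn (d x)^-1).+1 => //= n /= hn.
  rewrite min_r// -ler_pdivrMr// mul1r.
  rewrite (le_trans (ltW (truncnS_gt _)))// ler_nat//.
Qed.

(** Testing the equation with [psi x = x / (1 + x ^+ 2) * theta x] makes the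
    left-hand integrand [virial_weight x * theta x], whose first factor is
    positive on both half-lines at once and vanishes only at the origin, while
    [`|psi x| <= theta x] everywhere for [theta >= 0]. *)
Definition virial_weight (R : realType) (x : R) : R := x ^+ 2 / (1 + x ^+ 2).

Lemma sqr1D_gt0 (R : realType) (x : R) : 0 < 1 + x ^+ 2.
Proof. by rewrite ltr_pwDl// sqr_ge0. Qed.

Lemma continuous_sqr1D_inv (R : realType) : continuous (fun x : R => (1 + x ^+ 2)^-1).
Proof.
move=> x; apply: cvgV; first by rewrite gt_eqF// sqr1D_gt0.
by apply: cvgD; [exact: cvg_cst|exact: exprn_continuous].
Qed.

Lemma virial_weight_itv (R : realType) (x : R) : 0 <= virial_weight R x <= 1.
Proof.
rewrite /virial_weight; apply/andP; split.
  by rewrite divr_ge0 ?sqr_ge0// ltW// sqr1D_gt0.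
by rewrite ler_pdivrMr ?sqr1D_gt0// mul1r lerDr.
Qed.

Lemma measurable_virial_weight (R : realType) :
  measurable_fun [set: measurableTypeR R] (virial_weight R).
Proof.
apply: continuous_measurable_fun => x.
by apply: cvgM; [exact: exprn_continuous|exact: continuous_sqr1D_inv].
Qed.

(** The virial bound passes from continuous functions below [\1_U] to [\1_U]
    itself by dominated convergence. *)
Lemma steady_open_bound (R : realType) (gamma a : R)
    (mu : probability (measurableTypeR R) R) (U : set R) :
  steady_measure_solution gamma a mu -> open U -> (leb U < +oo)%E ->
  (\int[mu]_x (virial_weight R x * \1_U x)%:E <=
   (\int[mu \x mu]_z (`|z.1 - z.2| `^ gamma)%:E) * (2%:E * leb U))%E.
Proof.
move=> steady oU Uoo.
have mU : measurable (U : set (measurableTypeR R)) by exact: open_measurable.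
have UT : U != setT.
  apply: contraTneq Uoo => ->.
  by rewrite -set_itvNyy lebesgue_measure_itv.
have [theta [ctheta thetaU cvtheta]] := open_indicator_approx _ _ oU UT.
have th0 n x : 0 <= theta n x by case/andP: (thetaU n x).
have thU n x : theta n x <= \1_U x by case/andP: (thetaU n x).
have indU1 x : (\1_U x : R) <= 1 by rewrite indicE; case: (_ \in _).
have th1 n x : theta n x <= 1 by rewrite (le_trans (thU n x)).
have mtheta n : measurable_fun [set: measurableTypeR R] (theta n).
  exact: continuous_measurable_fun.
pose psi n x := x * (1 + x ^+ 2)^-1 * theta n x.
have cpsi n : continuous (psi n).
  move=> x; apply: cvgM; last exact: ctheta.
  by apply: cvgM; [exact: cvg_id|exact: continuous_sqr1D_inv].
have psi_le n x : `|psi n x| <= theta n x.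
  rewrite /psi normrM (ger0_norm (th0 n x)) ler_piMl//.
  rewrite normrM normfV (ger0_norm (ltW (sqr1D_gt0 _ x))).
  rewrite ler_pdivrMr ?sqr1D_gt0// mul1r -real_normK ?num_real//.
  have := sqr_ge0 (`|x| - 1); have := normr_ge0 x; nra.
have bpsi n : bounded_fun (psi n).
  exists 1; split => [|M M1 x _ /=]; first exact: num_real.
  by rewrite (le_trans (psi_le n x))// (le_trans (th1 n x))// ltW.
have mpsi n : measurable_fun [set: measurableTypeR R] (psi n).
  exact: continuous_measurable_fun.
have le_psiU n : (\int[leb]_t `|psi n t|%:E <= leb U)%E.
  have <- : (\int[leb]_t (\1_U t)%:E = leb U)%E.
    by rewrite integral_indic// setIT.
  apply: ge0_le_integral => //.
  - by apply/measurable_EFinP; exact: measurableT_comp.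
  - by apply/measurable_EFinP; exact: measurable_indic.
  - by move=> x _; rewrite lee_fin (le_trans (psi_le n x)).
have ipsi n : leb.-integrable setT (EFin \o psi n).
  apply/integrableP; split; first exact/measurable_EFinP.
  exact: le_lt_trans (le_psiU n) Uoo.
have bound n : (\int[mu]_x (virial_weight R x * theta n x)%:E <=
   (\int[mu \x mu]_z (`|z.1 - z.2| `^ gamma)%:E) * (2%:E * leb U))%E.
  have -> : (\int[mu]_x (virial_weight R x * theta n x)%:E =
             \int[mu]_x (x * psi n x)%:E)%E.
    by apply: eq_integral => x _; rewrite /virial_weight /psi expr2 !mulrA.
  apply: (le_trans (lee_abs _)).
  apply: (le_trans
    (steady_virial_bound _ _ _ _ _ steady (cpsi n) (bpsi n) (ipsi n))).
  rewrite lee_wpmul2l ?integral_ge0//.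
  by rewrite lee_wpmul2l.
have mg := @measurable_virial_weight R.
have mgt n : measurable_fun [set: measurableTypeR R]
    (fun x => (virial_weight R x * theta n x)%:E).
  by apply/measurable_EFinP; exact: measurable_funM.
have mgU : measurable_fun [set: measurableTypeR R]
    (fun x => (virial_weight R x * \1_U x)%:E).
  by apply/measurable_EFinP; apply: measurable_funM => //; exact: measurable_indic.
have [|||_ _ cv] := @dominated_convergence _ (measurableTypeR R) R mu setT
  measurableT (fun n x => (virial_weight R x * theta n x)%:E)
  (fun x => (virial_weight R x * \1_U x)%:E) (cst 1%:E) mgt mgU.
- apply: aeW => x _; apply: cvg_EFin; first exact: nearW.
  by apply: cvgM; [exact: cvg_cst|exact: cvtheta].
- exact: (finite_measure_integrable_cst mu 1 measurableT).
- apply: aeW => x n _; rewrite abse_EFin lee_fin.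
  have /andP[g0 g1] := virial_weight_itv R x.
  by rewrite normrM !ger0_norm// mulr_ile1.
rewrite -(cvg_lim _ cv)//; apply: lime_le.
  by apply/cvg_ex; eexists; exact: cv.
exact: nearW.
Qed.

(** Outer regularity covers [A] by open sets of arbitrarily small length, so
    [virial_weight] has integral zero on [A]; it is positive there, since [A]
    avoids the origin. *)
Lemma steady_null_off0 (R : realType) (gamma a : R)
    (mu : probability (measurableTypeR R) R)
    (A : set (measurableTypeR R)) :
  steady_measure_solution gamma a mu ->
  (\int[mu \x mu]_z (`|z.1 - z.2| `^ gamma)%:E < +oo)%E ->
  measurable A -> leb A = 0%E -> ~ A 0 -> mu A = 0%E.
Proof.
move=> steady wfin mA A0 nA0.
have w0 : (0 <= \int[mu \x mu]_z (`|z.1 - z.2| `^ gamma)%:E)%E.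
  exact: integral_ge0.
have mg := @measurable_virial_weight R.
have mgI (B : set (measurableTypeR R)) : measurable B ->
    measurable_fun [set: measurableTypeR R]
      (fun x => (virial_weight R x * \1_B x)%:E).
  move=> mB; apply/measurable_EFinP; apply: measurable_funM => //.
have gI0 (B : set (measurableTypeR R)) x : 0 <= virial_weight R x * \1_B x.
  by rewrite mulr_ge0//; case/andP: (virial_weight_itv R x).
have int0 : (\int[mu]_x `|(virial_weight R x * \1_A x)%:E| = 0)%E.
  under eq_integral do rewrite gee0_abs ?lee_fin//.
  apply/eqP; rewrite eq_le integral_ge0 ?andbT; last first.
    by move=> x _; rewrite lee_fin.
  apply/lee_addgt0Pr => e e0; rewrite add0e.
  move: wfin w0 (fun U => steady_open_bound R gamma a mu U steady).
  case: (\int[mu \x mu]_z _)%E => // c _; rewrite lee_fin => c0 bound.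
  (* [c + 1] instead of [c], as the kernel may have zero mass *)
  have d0 : 0 < e / (2 * (c + 1)) by rewrite divr_gt0// mulr_gt0// ltr_wpDl.
  have Aoo : (leb A < +oo)%E by rewrite A0.
  have [U [oU AU UA]] := @lebesgue_regularity_outer R A _ mA Aoo d0.
  have mU : measurable (U : set (measurableTypeR R)) by exact: open_measurable.
  have Ud : (leb U <= (e / (2 * (c + 1)))%:E)%E.
    rewrite -(setDUK AU) measureU//; [|exact: measurableD|exact: setDIK].
    by rewrite [X in (X + _)%E](_ : _ = 0%E) ?add0e; [exact: ltW|exact: A0].
  apply: (@le_trans _ _ (\int[mu]_x (virial_weight R x * \1_U x)%:E)%E).
    apply: ge0_le_integral => //.
    - by move=> x _; rewrite lee_fin.
    - exact: mgI.
    - exact: mgI.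
    - move=> x _; rewrite lee_fin ler_wpM2l//.
        by case/andP: (virial_weight_itv R x).
      rewrite !indicE; have [/set_mem/AU/mem_set->//|//] := boolP (x \in A).
  apply: (le_trans (bound _ oU _)); first by rewrite (le_lt_trans Ud)// ltry.
  apply: (@le_trans _ _ (c%:E * (2%:E * (e / (2 * (c + 1)))%:E))%E).
    by rewrite lee_wpmul2l ?lee_fin// lee_wpmul2l// lee_fin.
  rewrite -!EFinM lee_fin.
  have -> : c * (2 * (e / (2 * (c + 1)))) = e * (c / (c + 1)).
    by field; rewrite gt_eqF// ltr_wpDl.
  by rewrite ler_piMr ?(ltW e0)// ler_pdivrMr ?ltr_wpDl// mul1r lerDl.
have := (ae_eq_integral_abs mu measurableT (mgI _ mA)).1 int0.
move=> ae0; apply: measure_negligible => //; apply: negligibleS ae0.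
move=> x Ax /= /(_ I) [] /eqP; apply/negP.
rewrite indicE mem_set// mulr1 /virial_weight mulf_neq0//.
  by rewrite sqrf_eq0; apply/eqP => x0; apply: nA0; rewrite -x0.
by rewrite invr_eq0 gt_eqF// sqr1D_gt0.
Qed.

(** * No atom at the origin *)

(** Test functions concentrating at the origin: they decrease to the indicator
    of [0], and their virial [x * bump' x] stays bounded because they are
    dilations of a single profile. *)
Definition bump (R : realType) (n : nat) (x : R) : R := (1 + (n%:R * x) ^+ 2)^-1.

Lemma bump_itv (R : realType) (n : nat) (x : R) : 0 <= bump R n x <= 1.
Proof.
rewrite /bump invr_ge0 ltW ?sqr1D_gt0//=.
by rewrite invf_le1 ?sqr1D_gt0// lerDl sqr_ge0.
Qed.

Lemma bump_cvg (R : realType) (x : R) :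
  bump R n x @[n --> \oo] --> (\1_[set (0 : R)] x : R).
Proof.
rewrite indicE; have [x0|x0] := boolP (x \in [set 0]).
  move/set_mem : x0 => /= ->.
  under eq_fun do rewrite /bump mulr0 expr0n addr0 invr1.
  exact: cvg_cst.
have {}x0 : 0 < x ^+ 2.
  rewrite exprn_even_gt0//=; apply: contraNneq x0 => ->; exact/mem_set.
apply/cvgrPdist_le => e e0; exists (Num.truncn (e * x ^+ 2)^-1).+1 => //= n /= hn.
have /andP[b0 _] := bump_itv R n x.
rewrite sub0r normrN ger0_norm// /bump.
rewrite -[leRHS]invrK lef_pV2 ?posrE ?invr_gt0// ?sqr1D_gt0//.
have n1 : 1 <= n%:R :> R by rewrite ler1n (leq_ltn_trans _ hn).
have : (e * x ^+ 2)^-1 < n%:R by rewrite (lt_le_trans (truncnS_gt _))// ler_nat.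
rewrite invfM ltr_pdivrMr// => h.
rewrite (le_trans (ltW h))// exprMn.
apply: (@le_trans _ _ (n%:R ^+ 2 * x ^+ 2)); last by rewrite lerDr.
by rewrite ler_wpM2r ?(ltW x0)// expr2 ler_peMl// (le_trans ler01).
Qed.

Lemma is_derive_bump (R : realType) (n : nat) (x : R) :
  is_derive x 1 (bump R n)
    (- (2 * n%:R ^+ 2 * x) * (bump R n x) ^+ 2).
Proof.
have d1 : is_derive x 1 (fun y : R => 1 + (n%:R * y) ^+ 2) (2 * n%:R ^+ 2 * x).
  have -> : (fun y : R => 1 + (n%:R * y) ^+ 2) = cst 1 + (n%:R \*: id) ^+ 2.
    by apply/funext => y.
  apply: is_derive_eq; rewrite /GRing.scale/= add0r expr1 mulr1.
  by rewrite [n%:R *: x](_ : _ = n%:R * x)//; ring.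
have n0 : 1 + (n%:R * x) ^+ 2 != 0 by rewrite gt_eqF// sqr1D_gt0.
have d2 := @is_deriveV R (fun y => 1 + (n%:R * y) ^+ 2) x _ _ n0 d1.
rewrite /bump; apply: (is_derive_eq d2).
by rewrite /GRing.scale/= /bump exprVn; ring.
Qed.

Lemma derive1_bump (R : realType) (n : nat) :
  derive1 (bump R n) = fun x => - (2 * n%:R ^+ 2 * x) * (bump R n x) ^+ 2.
Proof.
by apply/funext => x; rewrite derive1E; case: (is_derive_bump R n x).
Qed.

(** In terms of [b = bump n x] the virial is a polynomial, and [b ^+ 2 - b]
    vanishes at both possible limits 0 and 1 of [b]. *)
Lemma bump_virial (R : realType) (n : nat) (x : R) :
  x * derive1 (bump R n) x = 2 * (bump R n x ^+ 2 - bump R n x).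
Proof.
rewrite derive1_bump /bump.
by field; rewrite gt_eqF// sqr1D_gt0.
Qed.

Lemma continuous_bump (R : realType) (n : nat) : continuous (bump R n).
Proof.
move=> x; apply/differentiable_continuous/derivable1_diffP.
by case: (is_derive_bump R n x).
Qed.

Lemma C1b_bump (R : realType) (n : nat) : C1b (bump R n).
Proof.
split.
- by move=> x; case: (is_derive_bump R n x).
- rewrite derive1_bump => x; apply: cvgM.
    by apply: cvgN; apply: cvgM; [exact: cvg_cst|exact: cvg_id].
  by rewrite expr2; apply: cvgM; exact: continuous_bump.
- exists 1; split => [|M M1 x _ /=]; first exact: num_real.
  have /andP[b0 b1] := bump_itv R n x.
  by rewrite ger0_norm// (le_trans b1)// ltW.
- exists n%:R; split => [|M M1 x _ /=]; first exact: num_real.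
  apply: (le_trans _ (ltW M1)).
  rewrite derive1_bump normrM normrN (ger0_norm (sqr_ge0 _)).
  have /andP[b0 b1] := bump_itv R n x.
  apply: (@le_trans _ _ (`|2 * n%:R ^+ 2 * x| * bump R n x)).
    by rewrite ler_wpM2l// expr2 ler_piMr.
  rewrite /bump ler_pdivrMr ?sqr1D_gt0// -[(_ * x) ^+ 2]real_normK ?num_real//.
  have -> : `|2 * n%:R ^+ 2 * x| = n%:R * (2 * `|n%:R * x|).
    by rewrite !normrM !normr_nat; ring.
  rewrite ler_wpM2l//.
  by have := sqr_ge0 (`|n%:R * x| - 1); nra.
Qed.

(** The transport term sees nothing of an atom at the origin, as the virial of
    the bumps tends to 0 pointwise.  Hence the collision term must balance by
    itself on the indicator of the origin. *)
Lemma bump_limit_equation (R : realType) (gamma a : R)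
    (mu : probability (measurableTypeR R) R) :
  steady_measure_solution gamma a mu ->
  (\int[mu \x mu]_z (`|z.1 - z.2| `^ gamma)%:E < +oo)%E ->
  (\int[mu \x mu]_z (`|z.1 - z.2| `^ gamma *
     collision_increment a (\1_[set (0 : R)]) z.1 z.2)%:E = 0)%E.
Proof.
move=> [_ steady] wfin.
set RHS := (X in X = _).
have mb n : measurable_fun [set: measurableTypeR R] (bump R n).
  exact: continuous_measurable_fun (continuous_bump R n).
have mdelta : measurable_fun [set: measurableTypeR R] (\1_[set (0 : R)] : R -> R).
  exact: measurable_indic.
have mw := @measurable_dist_powR R gamma.
have iw : (mu \x mu)%E.-integrable [set: plane R]
    (fun z => (4 * 1)%:E * (`|z.1 - z.2| `^ gamma)%:E)%E.
  apply: integrableZl => //; apply/integrableP; split => //.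
  by under eq_integral do rewrite gee0_abs ?lee_fin ?powR_ge0//.
have bump_le n t : `|bump R n t| <= 1.
  by have /andP[b0 b1] := bump_itv R n t; rewrite ger0_norm.
have [|||_ _ cvr] := @dominated_convergence _ (plane R) R (mu \x mu)%E setT
  measurableT (fun n z => (`|z.1 - z.2| `^ gamma *
     collision_increment a (bump R n) z.1 z.2)%:E)
  (fun z => (`|z.1 - z.2| `^ gamma *
     collision_increment a (\1_[set (0 : R)]) z.1 z.2)%:E)
  (fun z => (4 * 1)%:E * (`|z.1 - z.2| `^ gamma)%:E)%E
  (fun n => measurable_collision R gamma a _ (mb n))
  (measurable_collision R gamma a _ mdelta).
- apply: aeW => z _; apply: cvg_EFin; first exact: nearW.
  apply: cvgM; first exact: cvg_cst.
  by apply: cvgB; [apply: cvgB; [apply: cvgD|]|]; exact: bump_cvg.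
- exact: iw.
- apply: aeW => z n _; rewrite abse_EFin -EFinM lee_fin normrM mulrC.
  by rewrite (ger0_norm (powR_ge0 _ _)) ler_wpM2r ?powR_ge0//
       collision_increment_le.
have mvir n : measurable_fun [set: measurableTypeR R]
   (fun x => (x * derive1 (bump R n) x)%:E).
  apply/measurable_EFinP; under eq_fun do rewrite bump_virial.
  by apply: measurable_funM => //; apply: measurable_funB => //; exact: measurable_funX.
have [|||_ _ cvl] := @dominated_convergence _ (measurableTypeR R) R mu setT
  measurableT (fun n x => (x * derive1 (bump R n) x)%:E) (cst 0%E) (cst 2%:E)
  mvir (measurable_cst _).
- apply: aeW => x _; apply: cvg_EFin; first exact: nearW.
  (* an indicator equals its own square *)
  rewrite (_ : 0 = 2 * ((\1_[set (0 : R)] x : R) ^+ 2 - \1_[set (0 : R)] x)).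
    under eq_fun do rewrite /= bump_virial.
    apply: cvgM; first exact: cvg_cst.
    by apply: cvgB; [rewrite expr2; apply: cvgM|]; exact: bump_cvg.
  by rewrite indicE; case: (_ \in _); rewrite ?expr1n ?expr0n /= subrr mulr0.
- exact: (finite_measure_integrable_cst mu 2 measurableT).
- apply: aeW => x n _; rewrite abse_EFin lee_fin bump_virial.
  have /andP[b0 b1] := bump_itv R n x; rewrite normrM ger0_norm// ler_piMr//.
  by rewrite ler_norml; apply/andP; split; nra.
rewrite integral0 in cvl.
have cvl' : (2^-1%:E * \int[mu \x mu]_z (`|z.1 - z.2| `^ gamma *
     collision_increment a (bump R n) z.1 z.2)%:E)%E @[n --> \oo] --> (0 : \bar R)%E.
  rewrite -oppe0; under eq_fun do rewrite -(steady _ (C1b_bump R _)).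
  exact: cvgeN.
have : (2^-1%:E * RHS = 0)%E.
  by apply: (cvg_unique _ _ cvl') => //; exact: cvgeZl.
by move/eqP; rewrite mule_eq0 eqe invr_eq0 pnatr_eq0/= => /eqP.
Qed.

(** Almost no collision of positive rate lands at the origin.  For a given first
    velocity [x != 0] the second one is forced to be the nonzero point
    [- (c * x / d)], which is not an atom; for [x = 0] it is forced to be 0, and
    then the kernel vanishes. *)
Lemma gain_on_line_eq0 (R : realType) (gamma c d : R)
    (mu : probability (measurableTypeR R) R) :
  0 < gamma -> c != 0 -> d != 0 ->
  (forall x : R, x != 0 -> mu [set x] = 0%E) ->
  (\int[mu \x mu]_z (`|z.1 - z.2| `^ gamma *
     \1_[set (0 : R)] (c * z.1 + d * z.2))%:E = 0)%E.
Proof.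
move=> g0 c0 d0 mu0.
have mdelta : measurable_fun [set: measurableTypeR R] (\1_[set (0 : R)] : R -> R).
  exact: measurable_indic.
have mf : measurable_fun [set: plane R] (fun z => (`|z.1 - z.2| `^ gamma *
     \1_[set (0 : R)] (c * z.1 + d * z.2))%:E).
  apply/measurable_EFinP; apply: measurable_funM.
    by apply/measurable_EFinP; exact: measurable_dist_powR.
  apply: (measurableT_comp mdelta).
  by apply: measurable_funD; apply: measurable_funM.
rewrite fubini_tonelli1//.
apply: integral0_eq => x _; rewrite /fubini_F/=.
have inside y : y \in [set (0 : R)] -> y = 0 by move/set_mem.
have [->|x0] := eqVneq x 0.
  apply: integral0_eq => y _; rewrite indicE sub0r normrN mulr0 add0r.
  have [/inside/eqP|_] := boolP (_ \in _); last by rewrite mulr0.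
  rewrite mulf_eq0 (negbTE d0)/= => /eqP ->.
  by rewrite normr0 powR0 ?mul0r// gt_eqF.
have y0 : - (c * x / d) != 0 by rewrite oppr_eq0 !mulf_neq0// invr_eq0.
rewrite (ae_eq_integral (cst 0%E))//; first exact: integral0.
  exact: (measurableT_comp mf (measurable_pair1 x)).
exists [set - (c * x / d)]; split => //; first exact: mu0.
move=> y /= /existsNP[_ ny]; apply: contrapT => yx; apply: ny.
rewrite indicE; have [/inside cxy|_] := boolP (_ \in _); last by rewrite mulr0.
exfalso; apply: yx; apply: (mulfI d0).
by move/eqP : cxy; rewrite addrC addr_eq0 => /eqP ->; field.
Qed.

(** With a zero gain, the loss at the origin must vanish too; that loss is the
    mass of the atom times the moment of order [gamma] of [mu]. *)
Lemma steady_no_atom0 (R : realType) (gamma a : R)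
    (mu : probability (measurableTypeR R) R) :
  0 < gamma -> 0 < a -> a < 1 ->
  steady_measure_solution gamma a mu ->
  (0 < \int[mu]_x (`|x| `^ gamma)%:E)%E ->
  (\int[mu \x mu]_z (`|z.1 - z.2| `^ gamma)%:E < +oo)%E ->
  (forall x : R, x != 0 -> mu [set x] = 0%E) ->
  mu [set (0 : R)] = 0%E.
Proof.
move=> g0 a0 a1 steady m0 wfin mu0.
have b0 : 1 - a != 0 by rewrite subr_eq0 gt_eqF.
have an0 : a != 0 by rewrite gt_eqF.
pose w (z : plane R) := `|z.1 - z.2| `^ gamma.
pose D (u : plane R -> R) (z : plane R) : R := w z * \1_[set (0 : R)] (u z).
have w0 z : 0 <= w z by exact: powR_ge0.
have D0 u z : (0 <= (D u z)%:E)%E by rewrite lee_fin mulr_ge0.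
have mdelta : measurable_fun [set: measurableTypeR R] (\1_[set (0 : R)] : R -> R).
  exact: measurable_indic.
have mw : measurable_fun [set: plane R] w.
  by apply/measurable_EFinP; exact: measurable_dist_powR.
have mD u : measurable_fun [set: plane R] u ->
    measurable_fun [set: plane R] (fun z => (D u z)%:E).
  move=> mu_; apply/measurable_EFinP; apply: measurable_funM => //.
  exact: (measurableT_comp mdelta).
have iD u : measurable_fun [set: plane R] u ->
    (mu \x mu)%E.-integrable [set: plane R] (fun z => (D u z)%:E).
  move=> mu_; apply/integrableP; split; first exact: mD.
  apply: le_lt_trans wfin; apply: ge0_le_integral => //.
  - by apply: measurableT_comp => //; exact: mD.
  - exact: measurable_dist_powR.
  - move=> z _; rewrite gee0_abs// lee_fin ler_piMr//.
have m1 : measurable_fun [set: plane R] (fst : plane R -> R) by exact: measurable_fst.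
have m2 : measurable_fun [set: plane R] (snd : plane R -> R) by exact: measurable_snd.
pose u1 (z : plane R) := a * z.1 + (1 - a) * z.2.
pose u2 (z : plane R) := a * z.2 + (1 - a) * z.1.
have mu1 : measurable_fun [set: plane R] u1.
  by apply: measurable_funD; apply: measurable_funM.
have mu2 : measurable_fun [set: plane R] u2.
  by apply: measurable_funD; apply: measurable_funM.
have int1 : (\int[mu \x mu]_z (D u1 z)%:E = 0)%E.
  exact: gain_on_line_eq0.
have int2 : (\int[mu \x mu]_z (D u2 z)%:E = 0)%E.
  under eq_integral do rewrite /D /u2 addrC.
  exact: gain_on_line_eq0.
have := bump_limit_equation R gamma a mu steady wfin.
have -> : (\int[mu \x mu]_z (`|z.1 - z.2| `^ gamma *
     collision_increment a (\1_[set (0 : R)]) z.1 z.2)%:E =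
  \int[mu \x mu]_z (((D u1 z)%:E + (D u2 z)%:E) - ((D fst z)%:E + (D snd z)%:E)))%E.
  apply: eq_integral => z _; rewrite -!EFinD /D /collision_increment.
  by congr (_%:E); rewrite -/(w z) /u1 /u2; ring.
rewrite integralB//; [|by apply: integrableD => //; exact: iD..].
rewrite !ge0_integralD//; [|exact: mD..].
rewrite int1 int2 add0e sub0e => /eqP; rewrite oppe_eq0 padde_eq0 ?integral_ge0//.
move=> /andP[/eqP + _].
rewrite fubini_tonelli1//; last exact: mD.
have -> : (\int[mu]_x fubini_F mu (fun z => (D fst z)%:E) x =
  \int[mu]_x ((\int[mu]_y (`|y| `^ gamma)%:E) * (\1_[set (0:R)] x)%:E))%E.
  apply: eq_integral => x _; rewrite /fubini_F /D /w/= !indicE.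
  have [/set_mem -> /=|_] := boolP (x \in _).
    by rewrite mule1; apply: eq_integral => y _; rewrite mulr1 sub0r normrN.
  by rewrite mule0; apply: integral0_eq => y _; rewrite mulr0.
rewrite ge0_integralZl//; last exact: ltW.
- rewrite integral_indic// setIT => /eqP; rewrite mule_eq0 gt_eqF//= => /eqP.
  exact.
- by apply/measurable_EFinP; exact: mdelta.
Qed.

(** * The density *)

Lemma powR_sqr1D_le (R : realType) (k x : R) : 0 <= k ->
  (1 + x ^+ 2) `^ (k / 2) <= 2 `^ k * (1 + `|x| `^ k).
Proof.
move=> k0; apply: (@le_trans _ _ ((1 + `|x|) `^ k)).
  have -> : (1 + `|x|) `^ k = ((1 + `|x|) ^+ 2) `^ (k / 2).
    by rewrite -powR_mulrn ?addr_ge0// -powRrM; congr (_ `^ _); field.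
  rewrite ge0_ler_powR ?nnegrE ?divr_ge0 ?sqr_ge0 ?(ltW (sqr1D_gt0 _ x))//.
  by rewrite -(real_normK (num_real x)); have := normr_ge0 x; nra.
have := powR_distr_le R k 1 (- `|x|) k0.
by rewrite opprK !normrN normr1 powR1 normr_id ger0_norm ?addr_ge0.
Qed.

Lemma moment_sqr1D_finite (R : realType) (k : R)
    (mu : probability (measurableTypeR R) R) : 0 <= k ->
  (\int[mu]_x (`|x| `^ k)%:E < +oo ->
   \int[mu]_x ((1 + x ^+ 2) `^ (k / 2))%:E < +oo)%E.
Proof.
move=> k0 hk.
apply: (@le_lt_trans _ _
    (\int[mu]_x ((2 `^ k)%:E * (1%:E + (`|x| `^ k)%:E)))%E).
  apply: ge0_le_integral => //.
  - by move=> x _; rewrite lee_fin powR_ge0.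
  - apply/measurable_EFinP; apply: (measurableT_comp (measurable_powR _)).
    by apply: measurable_funD => //; exact: measurable_funX.
  - apply: measurable_funeM; apply: emeasurable_funD => //.
    exact: measurable_powR_norm.
  - by move=> x _; rewrite -EFinD -EFinM lee_fin powR_sqr1D_le.
rewrite ge0_integralZl//; last 2 first.
- by apply: emeasurable_funD => //; exact: measurable_powR_norm.
- by move=> x _; rewrite adde_ge0// lee_fin powR_ge0.
rewrite ge0_integralD//; last exact: measurable_powR_norm.
rewrite integral_cst//= mul1e probability_setT.
by rewrite lte_mul_pinfty ?lee_fin ?powR_ge0// lte_add_pinfty// ltry.
Qed.

(** The weighted norm of the density is a moment of [mu], as
    [1 + x ^+ 2 <= (1 + `|x|) ^+ 2]. *)
Lemma density_weighted_L1 (R : realType) (k : R)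
    (mu : probability (measurableTypeR R) R) : 0 <= k ->
  mu `<< leb -> (\int[mu]_x (`|x| `^ k)%:E < +oo)%E ->
  exists G : R -> R, [/\ forall x, 0 <= G x, weighted_L1 k G &
    forall A : set (measurableTypeR R), measurable A ->
      (mu A = \int[leb]_(x in A) (G x)%:E)%E].
Proof.
move=> k0 muleb hk.
pose F := Radon_Nikodym_SigmaFinite.f mu (@lebesgue_measure R).
have Ffin x : F x \is a fin_num by exact: Radon_Nikodym_SigmaFinite.f_fin_num.
have F0 x : (0 <= F x)%E by exact: Radon_Nikodym_SigmaFinite.f_ge0.
have FE x : (fine (F x))%:E = F x by rewrite fineK.
exists (fine \o F); split.
- by move=> x; rewrite fine_ge0.
- split.
    rewrite (_ : EFin \o _ = F); last by apply/funext => x /=; rewrite FE.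
    exact: Radon_Nikodym_SigmaFinite.f_integrable.
  have -> : (\int[leb]_x (((1 + x ^+ 2) `^ (k / 2)) * `|(fine \o F) x|)%:E =
    \int[leb]_x (((1 + x ^+ 2) `^ (k / 2))%:E * F x))%E.
    by apply: eq_integral => x _; rewrite ger0_norm ?fine_ge0//= EFinM FE.
  rewrite Radon_Nikodym_SigmaFinite.change_of_variables//; last 2 first.
  - by move=> x; rewrite lee_fin powR_ge0.
  - apply/measurable_EFinP; apply: (measurableT_comp (measurable_powR _)).
    by apply: measurable_funD => //; exact: measurable_funX.
  - exact: moment_sqr1D_finite.
- move=> A mA; under eq_integral do rewrite /= FE.
  exact: Radon_Nikodym_SigmaFinite.f_integral.
Qed.

Theorem theorem1p5 (R : realType) (gamma a : R)
    (gamma_gt0 : 0 < gamma) (a_gt0 : 0 < a) (a_lt1 : a < 1)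
    (mu : probability (measurableTypeR R) R)
    (mu_steady : steady_measure_solution gamma a mu)
    (m_gamma_gt0 : (0 < \int[mu]_xi (`|xi| `^ gamma)%:E)%E) :
  mu `<< @lebesgue_measure R /\
  exists G : R -> R,
    [/\ forall xi, 0 <= G xi,
        weighted_L1 (Num.max gamma 2) G
      & forall A : set (measurableTypeR R), measurable A ->
          (mu A = \int[@lebesgue_measure R]_(xi in A) (G xi)%:E)%E].
Proof.
have [[moment _] _] := mu_steady.
have k0 : 0 <= Num.max gamma 2 by rewrite le_max ler0n orbT.
have wfin : (\int[mu \x mu]_z (`|z.1 - z.2| `^ gamma)%:E < +oo)%E.
  apply: interaction_finite; first exact: ltW.
  by apply: moment_finite_le moment; rewrite ?(ltW gamma_gt0)// le_max lexx.
have off0 := steady_null_off0 R gamma a mu _ mu_steady wfin.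
have atom0 : mu [set (0 : R)] = 0%E.
  apply: (steady_no_atom0 R gamma a) => // x x0.
  apply: off0 => //; first exact: lebesgue_measure_set1.
  by move=> /= x0'; rewrite -x0' eqxx in x0.
have muleb : mu `<< @lebesgue_measure R.
  move=> N nullN A mA AN.
  have mA0 : measurable (A `\ (0 : R)) by exact: measurableD.
  have A0 : mu (A `\ (0 : R)) = 0%E.
    apply: off0 => //; last by move=> [_]; exact.
    by apply: nullN => // x [Ax _]; exact: AN.
  apply/eqP; rewrite eq_le measure_ge0 andbT.
  apply: (@le_trans _ _ (mu ((A `\ (0 : R)) `|` [set (0 : R)]))).
    apply: le_measure; rewrite ?inE//; first exact: measurableU.
    by move=> x Ax; have [->|/eqP x0] := eqVneq x 0; [right|left].
  have sum0 : (mu (A `\ 0%R) + mu [set 0%R] <= 0%E)%E by rewrite A0 atom0 adde0.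
  by apply: le_trans (measureU2 _ _ _) sum0.
by split => //; exact: density_weighted_L1.
Qed.
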